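(* Let $n\ge2$, let $c_{ij}=c_{ji}$, $c'=(c_1,\dots,c_n)$ and $c$ be real constants, let $h(x)=c_{ij}x^ix^j+\langle c',x\rangle+c$, and let $U\subset\mathbb{R}^n$ be an open set on which $h\neq0$ and on which $$F(x,y)=\sqrt{\frac{4h(x)\,c_{ij}y^iy^j-4(c_{ij}x^iy^j)^2-4\langle c',y\rangle\, c_{ij}x^iy^j-\langle c',y\rangle^2}{(2h(x))^2}}$$ is a Finsler metric (in particular the radicand is strictly positive for $y\ne0$). Then the geodesic spray coefficients $G^i$ and the Jacobi endomorphism $R^i_{\ j}$ of $F$ are given by $$G^i=-\frac{2c_{rs}x^ry^s+\langle c',y\rangle}{2h(x)}\,y^i,$$ $$R^i_{\ j}=\frac{4h(x)c_{rs}y^ry^s-(2c_{rs}x^ry^s+\langle c',y\rangle)^2}{(2h(x))^2}\,\delta^i_j-\frac{4h(x)c_{rj}y^r-(2c_{rs}x^ry^s+\langle c',y\rangle)(2c_{rj}x^r+c_j)}{(2h(x))^2}\,y^i .$$ Moreover, $F$ has constant flag curvature $1$.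
   Context: Summation over repeated indices is understood; $\langle\cdot,\cdot\rangle$ is the Euclidean inner product. A Finsler metric on an open set $U\subset\mathbb{R}^n$ is a map $F:U\times\mathbb{R}^n\to\mathbb{R}$, smooth and strictly positive for $y\ne0$, zero at $y=0$, positively $1$-homogeneous in $y$, such that $\left(\frac{\partial^2E}{\partial y^i\partial y^j}\right)$, $E=\frac12F^2$, has rank $n$ for $y\neq0$. Its geodesic spray is the unique vector field $S=y^i\frac{\partial}{\partial x^i}-2G^i\frac{\partial}{\partial y^i}$ on $U\times(\mathbb{R}^n\setminus\{0\})$ with $S\left(\frac{\partial E}{\partial y^i}\right)-\frac{\partial E}{\partial x^i}=0$; the functions $G^i(x,y)$ are the spray coefficients. The Jacobi endomorphism is $R^i_{\ j}=2\frac{\partial G^i}{\partial x^j}-S(N^i_j)-N^i_kN^k_j$, where $N^i_j=\frac{\partial G^i}{\partial y^j}$. $F$ has constant flag curvature $\kappa$ if $R^i_{\ j}=\kappa\left(F^2\delta^i_j-F\frac{\partial F}{\partial y^j}y^i\right)$ with $\kappa$ a constant. *)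

(* Defs.v *)
From mathcomp Require Import all_boot all_order all_algebra.
From mathcomp Require Import all_classical all_reals all_analysis.
Set Implicit Arguments.
Unset Strict Implicit.
Unset Printing Implicit Defensive.
Import Order.TTheory GRing.Theory Num.Theory.
Import numFieldNormedType.Exports.
Local Open Scope classical_set_scope.
Local Open Scope ring_scope.

(* Points of the tangent bundle of R^n are pairs p = (x, y): x = p.1 is the
   base point and y = p.2 the fibre coordinate.  Functions defined only on a
   part of it are total functions whose values elsewhere are irrelevant; all
   derivatives below are taken at points of open sets, so they do not depend
   on those values. *)

Section TangentBundle.
Variables (R : realType) (n : nat).
Notation V := 'rV[R]_n.
Notation TV := ('rV[R]_n * 'rV[R]_n)%type.
Implicit Types (U : set V) (A : set TV) (F f : TV -> R) (p : TV).

Definition xdir (i : 'I_n) : TV := (delta_mx 0 i, 0).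
Definition ydir (i : 'I_n) : TV := (0, delta_mx 0 i).

Definition dx (i : 'I_n) f : TV -> R := fun p => 'D_(xdir i) f p.
Definition dy (i : 'I_n) f : TV -> R := fun p => 'D_(ydir i) f p.

(* f is of class C^k on the open set A. *)
Fixpoint Ck (k : nat) A f : Prop :=
  (forall p, A p -> {for p, continuous f}) /\
  (if k is k'.+1 then
     forall i : 'I_n,
       [/\ forall p, A p -> derivable f p (xdir i), Ck k' A (dx i f),
           forall p, A p -> derivable f p (ydir i) & Ck k' A (dy i f)]
   else True).

Definition smooth_on A f : Prop := forall k, Ck k A f.

Definition slit_bundle U : set TV := [set p | U p.1 /\ p.2 != 0].

Definition energy F : TV -> R := fun p => 2^-1 * F p ^+ 2.

(* To be used for open U. *)
Record is_finsler_metric U F : Prop := {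
  finsler_smooth : smooth_on (slit_bundle U) F;
  finsler_gt0 : forall x y : V, U x -> y != 0 -> 0 < F (x, y);
  finsler_at0 : forall x : V, U x -> F (x, 0) = 0;
  finsler_homogeneous : forall (x y : V) (t : R),
    U x -> 0 < t -> F (x, t *: y) = t * F (x, y);
  finsler_regular : forall p, slit_bundle U p ->
    \rank (\matrix_(i < n, j < n) dy i (dy j (energy F)) p) = n
}.

(* The derivation S = y^i d/dx^i - 2 G^i d/dy^i. *)
Definition spray (G : 'I_n -> TV -> R) f : TV -> R := fun p =>
  \sum_(i < n) p.2 0 i * dx i f p - 2 * \sum_(i < n) G i p * dy i f p.

Definition is_geodesic_spray U F (G : 'I_n -> TV -> R) : Prop :=
  forall p, slit_bundle U p -> forall i : 'I_n,
    spray G (dy i (energy F)) p - dx i (energy F) p = 0.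

Definition nonlinear_connection (G : 'I_n -> TV -> R) (i j : 'I_n) : TV -> R :=
  dy j (G i).

Definition jacobi_endomorphism (G : 'I_n -> TV -> R) (i j : 'I_n) : TV -> R :=
  let N := nonlinear_connection G in
  fun p => 2 * dx j (G i) p - spray G (N i j) p
           - \sum_(k < n) N i k p * N k j p.

(* For a Finsler metric the geodesic spray coefficients G are determined on
   slit_bundle U, so the condition does not depend on the choice of G. *)
Definition has_constant_flag_curvature U F (kappa : R) : Prop :=
  exists2 G : 'I_n -> TV -> R, is_geodesic_spray U F G &
    forall p, slit_bundle U p -> forall i j : 'I_n,
      jacobi_endomorphism G i j p =
      kappa * (F p ^+ 2 * (i == j)%:R - F p * dy j F p * p.2 0 i).

Definition dotp (u v : V) : R := \sum_(i < n) u 0 i * v 0 i.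

Definition bilin (C : 'M[R]_n) (u v : V) : R :=
  \sum_(i < n) \sum_(j < n) C i j * u 0 i * v 0 j.

Definition hfun (C : 'M[R]_n) (c' : V) (c : R) (x : V) : R :=
  bilin C x x + dotp c' x + c.

Definition quadratic_metric (C : 'M[R]_n) (c' : V) (c : R) : TV -> R :=
  fun p => let x := p.1 in let y := p.2 in
  Num.sqrt ((4 * hfun C c' c x * bilin C y y - 4 * bilin C x y ^+ 2
             - 4 * dotp c' y * bilin C x y - dotp c' y ^+ 2)
            / (2 * hfun C c' c x) ^+ 2).

End TangentBundle.

(* Main.v *)
From HB Require Import structures.
Require Import Defs.
From mathcomp Require Import all_boot all_order all_algebra.
From mathcomp Require Import all_classical all_reals all_analysis.
From mathcomp Require Import ring.
Import Order.TTheory GRing.Theory Num.Theory.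
Import numFieldNormedType.Exports.
Local Open Scope classical_set_scope.
Local Open Scope ring_scope.

(** Write [A = dh(y)] for the derivative of [h] along [y], [B = C(y, y)] and
    [w = C y].  Since [2 C(x, y) + <c', y> = A], the radicand is
    [(4 h B - A^2) / (4 h^2)], so on the slit bundle the energy is the rational
    function [B / (2 h) - A^2 / (8 h^2)] ([energyE]) and its fibre derivative,
    the momentum, is [w / h - A dh / (4 h^2)] ([dy_energy]).

    The candidate spray is [G = P y] with [P = - A / (2 h)].  Because [G] is
    proportional to [y], the spray acts on a function homogeneous of degree [k]
    in [y] as the base derivative along [y] plus [k A / h] times the function.
    The geodesic equation then becomes a rational identity in [h], [A], [B],
    [w_i] and [dh(e_i)] ([qspray_geodesic]).  Nondegeneracy of the energy makes
    its solution unique ([geodesic_spray_unique]), which gives the formula for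
    the spray coefficients.  All data are determined on the slit bundle, which
    is open, hence any geodesic spray has the derivatives of [P y] there
    ([jacobi_eq_on]).

    Computing the Jacobi endomorphism of [P y] gives
    [F^2 delta_ij - p_j y^i] where [p] is the momentum ([jacobi_qspray]).
    As [p_j] is the fibre derivative of [F^2 / 2], it equals [F F_{y^j}]
    ([mul_dy_metric]), and this is the condition of constant flag curvature
    one. *)

(** * Differentials of real functions on a normed space *)

Section Differentials.
Context {R : realType} {V : normedModType R}.
Implicit Types (f g df dg : V -> R) (p : V).

(** The rules of differentiation are stated for pointwise expressions with
    pointwise differentials, so that composing them yields formulas on which
    [ring] and [field] act after introducing one tangent vector. *)
Lemma is_diff_ext f g df dg p :
  is_diff p f df -> f =1 g -> df =1 dg -> is_diff p g dg.
Proof. by move=> hf /funext <- /funext <-. Qed.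

Lemma is_diff_addf f g df dg p : is_diff p f df -> is_diff p g dg ->
  is_diff p (fun q => f q + g q) (fun v => df v + dg v).
Proof. by move=> hf hg; exact: is_diffD. Qed.

Lemma is_diff_mulf f g df dg p : is_diff p f df -> is_diff p g dg ->
  is_diff p (fun q => f q * g q) (fun v => f p * dg v + g p * df v).
Proof. by move=> hf hg; exact: is_diffM. Qed.

Lemma is_diff_cstf (a : R) p : is_diff p (fun=> a) (fun=> 0).
Proof. exact: (is_diff_cst a p). Qed.

Lemma is_diff_scalef (a : R) f df p : is_diff p f df ->
  is_diff p (fun q => a * f q) (fun v => a * df v).
Proof. by move=> hf; exact: (is_diffZ a). Qed.

Lemma is_diff_invf f df p : is_diff p f df -> f p != 0 ->
  is_diff p (fun q => (f q)^-1) (fun v => - (f p) ^- 2 * df v).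
Proof.
move=> hf fp0; apply: DiffDef; first exact: differentiableV.
by rewrite diffV// diff_val.
Qed.

Lemma is_diff_sumf (I : Type) (r : seq I) (f df : I -> V -> R) p :
  (forall i, is_diff p (f i) (df i)) ->
  is_diff p (fun q => \sum_(i <- r) f i q) (fun v => \sum_(i <- r) df i v).
Proof.
move=> hf; elim: r => [|i r IHr].
  have nilE (F : I -> V -> R) : (fun q => \sum_(i <- [::]) F i q) = (fun=> 0).
    by apply/funext => q; rewrite big_nil.
  by rewrite !nilE; exact: is_diff_cstf.
have consE (F : I -> V -> R) : (fun q => \sum_(j <- i :: r) F j q) =
    (fun q => F i q + \sum_(j <- r) F j q).
  by apply/funext => q; rewrite big_cons.
by rewrite !consE; exact: is_diff_addf.
Qed.

Lemma is_diff_linear f p : linear f -> continuous f -> is_diff p f f.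
Proof.
move=> lin cf; pose L : {linear V -> R} := HB.pack f
  (GRing.isLinear.Build _ _ _ _ _ lin).
apply: DiffDef; first exact: (@linear_differentiable _ _ _ L).
exact: (@diff_lin _ _ _ L).
Qed.

End Differentials.

(** * Locality, sprays and bilinear forms on the tangent bundle *)

Section Coordinates.
Context {R : realType} {n : nat}.
Notation V := 'rV[R]_n.
Notation TV := (V * V)%type.
Implicit Types (x y u w : V) (p : TV).

Lemma is_diff_base_coord (i : 'I_n) p :
  is_diff p (fun q : TV => q.1 0 i) (fun v => v.1 0 i).
Proof.
apply: is_diff_linear => [a u v|q]; first by rewrite /= !mxE.
apply: (@continuous_comp _ _ _ fst (fun M : V => M 0 i)); first exact: cvg_fst.
exact: coord_continuous.
Qed.

Lemma is_diff_fibre_coord (i : 'I_n) p :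
  is_diff p (fun q : TV => q.2 0 i) (fun v => v.2 0 i).
Proof.
apply: is_diff_linear => [a u v|q]; first by rewrite /= !mxE.
apply: (@continuous_comp _ _ _ snd (fun M : V => M 0 i)); first exact: cvg_snd.
exact: coord_continuous.
Qed.

Lemma open_slit_bundle (U : set V) : open U -> open (slit_bundle U).
Proof.
move=> oU; have -> : slit_bundle U = fst @^-1` U `&` snd @^-1` [set~ 0].
  by apply/seteqP; split=> p /= [? /eqP].
apply: openI; apply: open_comp => //.
- by move=> p _; exact: cvg_fst.
- by move=> p _; exact: cvg_snd.
- apply: closed_openC; apply: accessible_closed_set1.
  by apply: hausdorff_accessible; exact: norm_hausdorff.
Qed.

(** Equality of two functions matters only on an open set: this is how every
    derivative of the metric, and of an arbitrary geodesic spray, is replaced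
    by that of its closed form. *)
Lemma derive_eq_on {A : set TV} {f g : TV -> R} {p : TV} (v : TV) :
  open A -> A p -> (forall q, A q -> f q = g q) -> 'D_v f p = 'D_v g p.
Proof.
move=> oA Ap fg; apply: near_eq_derive; near=> q; apply: fg.
by near: q; exact: open_nbhs_nbhs.
Unshelve. all: by end_near. Qed.

Lemma spray_eq_on {A : set TV} (G H : 'I_n -> TV -> R) (f g : TV -> R) p :
  open A -> A p -> (forall i, G i p = H i p) -> (forall q, A q -> f q = g q) ->
  spray G f p = spray H g p.
Proof.
move=> oA Ap GH fg; rewrite /spray; congr (_ - 2 * _); apply: eq_bigr => i _.
  by rewrite /dx (derive_eq_on _ oA Ap fg).
by rewrite /dy (derive_eq_on _ oA Ap fg) GH.
Qed.

Lemma deriveE_diff f df p v : is_diff p f df -> 'D_v f p = df v :> R.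
Proof. by move=> hf; rewrite deriveE// diff_val. Qed.

(** The Jacobi endomorphism contains second derivatives of [G], hence equality
    on an open set is used twice: once for the connection, once for its
    derivative along the spray. *)
Lemma jacobi_eq_on {A : set TV} (G H : 'I_n -> TV -> R) (i j : 'I_n) p :
  open A -> A p -> (forall k q, A q -> G k q = H k q) ->
  jacobi_endomorphism G i j p = jacobi_endomorphism H i j p.
Proof.
move=> oA Ap GH; have NE k l q : A q ->
    nonlinear_connection G k l q = nonlinear_connection H k l q.
  by move=> Aq; exact: (derive_eq_on _ oA Aq (GH k)).
rewrite /jacobi_endomorphism /dx (derive_eq_on _ oA Ap (GH i)).
rewrite (spray_eq_on G H _ _ _ oA Ap (fun k => GH k p Ap) (NE i j)).
by congr (_ - _); apply: eq_bigr => k _; rewrite !NE.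
Qed.

(** A spray is a vector field, so on a differentiable function it acts as one
    directional derivative; this replaces its two sums over coordinates by a
    single evaluation of the differential. *)
Lemma sprayE (G : 'I_n -> TV -> R) f df p : is_diff p f df ->
  spray G f p = df (p.2, - 2 *: \row_i G i p).
Proof.
move=> hf; have dfE := @diff_val _ _ _ _ _ _ _ hf.
have -> : (p.2, - 2 *: \row_i G i p) =
    \sum_(i < n) p.2 0 i *: xdir R i + \sum_(i < n) (- 2 * G i p) *: ydir R i.
  rewrite [LHS]surjective_pairing [RHS]surjective_pairing; congr pair => /=.
    rewrite !raddf_sum/= -row_sum_delta big1 ?addr0// => i _.
    by rewrite scaler0.
  rewrite !raddf_sum/= big1 ?add0r => [|i _]; last by rewrite scaler0.
  rewrite [LHS]row_sum_delta; apply: eq_bigr => i _.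
  by rewrite !mxE.
rewrite -dfE linearD !linear_sum /spray mulr_sumr -sumrN; congr (_ + _).
  by apply: eq_bigr => i _; rewrite linearZ/= /dx deriveE.
apply: eq_bigr => i _.
by rewrite [RHS]linearZ/= /dy deriveE// -[RHS]/(_ * _); ring.
Qed.

(** The difference of the geodesic equations of [G] and [H] is [-2] times the
    row [G - H] multiplied by the fibre Hessian of the energy, which is
    invertible. *)
Lemma geodesic_spray_unique (U : set V) (F : TV -> R)
    (G H : 'I_n -> TV -> R) p :
  is_finsler_metric U F -> is_geodesic_spray U F G -> is_geodesic_spray U F H ->
  slit_bundle U p -> forall i, G i p = H i p.
Proof.
move=> FF GF HF Up.
set M : 'M[R]_n := \matrix_(i < n, j < n) dy i (dy j (energy F)) p.
have Mfree : row_free M by rewrite /row_free (finsler_regular FF Up).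
suff dM0 : \row_i (G i p - H i p) *m M = 0 *m M.
  move=> i; have /rowP/(_ i) := row_free_inj Mfree dM0.
  by rewrite !mxE => /subr0_eq.
rewrite mul0mx; apply/rowP => j; rewrite !mxE.
have /eqP := etrans (GF p Up j) (esym (HF p Up j)).
rewrite (inj_eq (addIr _)) (inj_eq (addrI _)) eqr_opp => /eqP.
have two0 : (2 : R) != 0 by rewrite pnatr_eq0.
move=> /(mulfI two0) /eqP.
rewrite -subr_eq0 -sumrB => /eqP E; apply: etrans E; apply: eq_bigr => i _.
by rewrite !mxE mulrBl.
Qed.

Lemma dotpDr u v w : dotp u (v + w) = dotp u v + dotp u w.
Proof. by rewrite -big_split; apply: eq_bigr => i _; rewrite mxE mulrDr. Qed.

Lemma dotpZr (a : R) u v : dotp u (a *: v) = a * dotp u v.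
Proof.
by rewrite /dotp mulr_sumr; apply: eq_bigr => i _; rewrite mxE mulrCA.
Qed.

Lemma dotp_delta u (j : 'I_n) : dotp u (delta_mx 0 j) = u 0 j.
Proof.
rewrite /dotp (bigD1 j)//= big1 ?addr0 => [|i ij]; rewrite mxE !eqxx/=.
  by rewrite mulr1.
by rewrite (negPf ij) mulr0.
Qed.

Lemma is_diff_dotp u (g dg : TV -> V) p :
  (forall i, is_diff p (fun q => g q 0 i) (fun v => dg v 0 i)) ->
  is_diff p (fun q => dotp u (g q)) (fun v => dotp u (dg v)).
Proof. by move=> hg; apply: is_diff_sumf => i; exact: is_diff_scalef. Qed.

(** The square of the connection of a spray with coefficients [P y^i], where
    [b] is the fibre gradient of [P]; the inner sum is [P] again by Euler's
    identity when [P] is homogeneous of degree one. *)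
Lemma sum_connection_sqr y (P : R) (b : 'I_n -> R) (i j : 'I_n) :
  \sum_(k < n) (P * (i == k)%:R + b k * y 0 i)
                 * (P * (k == j)%:R + b j * y 0 k)
  = P ^+ 2 * (i == j)%:R
    + (2 * P + \sum_(k < n) y 0 k * b k) * b j * y 0 i.
Proof.
have sumK (g : 'I_n -> R) (l : 'I_n) : \sum_(k < n) (k == l)%:R * g k = g l.
  rewrite (bigD1 l)//= eqxx mul1r big1 ?addr0// => k /negPf ->.
  by rewrite mul0r.
transitivity (\sum_(k < n) ((k == i)%:R * (P * (P * (k == j)%:R + b j * y 0 k))
    + ((k == j)%:R * (b k * y 0 i * P) + y 0 k * b k * (b j * y 0 i)))).
  by apply: eq_bigr => k _; rewrite (eq_sym i k); ring.
by rewrite !big_split/= !sumK -mulr_suml; ring.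
Qed.

Section Bilin.
Variable C : 'M[R]_n.

Lemma bilin_dotp u v : bilin C u v = dotp (u *m C) v.
Proof.
rewrite /bilin /dotp exchange_big; apply: eq_bigr => j _.
rewrite mxE mulr_suml; apply: eq_bigr => i _; congr (_ * _); exact: mulrC.
Qed.

Lemma bilinZr (a : R) u v : bilin C u (a *: v) = a * bilin C u v.
Proof. by rewrite !bilin_dotp dotpZr. Qed.

Lemma bilinDr u v w : bilin C u (v + w) = bilin C u v + bilin C u w.
Proof. by rewrite !bilin_dotp dotpDr. Qed.

Lemma bilin0r u : bilin C u 0 = 0.
Proof. by rewrite -(scale0r 0) bilinZr mul0r. Qed.

Lemma bilin_delta u (j : 'I_n) :
  bilin C u (delta_mx 0 j) = \sum_(r < n) C r j * u 0 r.
Proof.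
rewrite bilin_dotp dotp_delta mxE; apply: eq_bigr => r _; exact: mulrC.
Qed.

Lemma is_diff_bilin (f df g dg : TV -> V) p :
  (forall i, is_diff p (fun q => f q 0 i) (fun v => df v 0 i)) ->
  (forall i, is_diff p (fun q => g q 0 i) (fun v => dg v 0 i)) ->
  is_diff p (fun q => bilin C (f q) (g q))
    (fun v => bilin C (df v) (g p) + bilin C (f p) (dg v)).
Proof.
move=> hf hg; have h i := is_diff_sumf _ (index_enum 'I_n) _ _ p (fun j =>
  is_diff_mulf _ _ _ _ p (is_diff_scalef (C i j) _ _ p (hf i)) (hg j)).
apply: (is_diff_eq (is_diff_sumf _ (index_enum 'I_n) _ _ p h)).
apply/funext => v; rewrite -big_split; apply: eq_bigr => i _.
rewrite -big_split; apply: eq_bigr => j _ /=; ring.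
Qed.

Hypothesis symC : forall i j, C i j = C j i.

Lemma bilinC u v : bilin C u v = bilin C v u.
Proof.
rewrite /bilin exchange_big; apply: eq_bigr => i _; apply: eq_bigr => j _.
by rewrite symC mulrAC.
Qed.

Lemma bilin0l u : bilin C 0 u = 0.
Proof. by rewrite (bilinC) bilin0r. Qed.

End Bilin.

End Coordinates.

(** * The quadratic metric *)

Section QuadraticMetric.
Context {R : realType} {n : nat}.
Variables (C : 'M[R]_n) (c' : 'rV[R]_n) (c : R).
Hypothesis symC : forall i j, C i j = C j i.
Notation V := 'rV[R]_n.
Notation TV := (V * V)%type.
Notation e_ j := (delta_mx 0 j : V).
Notation h := (hfun C c' c).
Implicit Types (x y u w : V) (p q v : TV).

(** The differential of [h] at [x] applied to [u], see [is_diff_hfun]. *)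
Definition dh x u : R := 2 * bilin C x u + dotp c' u.

Lemma dhZ x (a : R) u : dh x (a *: u) = a * dh x u.
Proof. by rewrite /dh bilinZr dotpZr; ring. Qed.

Lemma dhD x u w : dh x (u + w) = dh x u + dh x w.
Proof. by rewrite /dh bilinDr dotpDr; ring. Qed.

Lemma dh0 x : dh x 0 = 0.
Proof. by rewrite -(scale0r 0) dhZ mul0r. Qed.

Lemma dh_sum x u : dh x u = \sum_(k < n) u 0 k * dh x (e_ k).
Proof.
rewrite [in LHS](row_sum_delta u) (big_morph _ (dhD x) (dh0 x)).
by apply: eq_bigr => k _; rewrite dhZ.
Qed.

Lemma is_diff_hfun p : is_diff p (fun q => h q.1) (fun v => dh p.1 v.1).
Proof.
have cx i := is_diff_base_coord i p.
apply: (is_diff_eq (is_diff_addf _ _ _ _ p (is_diff_addf _ _ _ _ p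
  (is_diff_bilin C fst fst fst fst p cx cx) (is_diff_dotp c' _ _ p cx))
  (is_diff_cstf c p))).
by apply/funext => v; rewrite /dh (bilinC _ symC v.1); ring.
Qed.

Lemma is_diff_dh (g dg : TV -> V) p :
  (forall i, is_diff p (fun q => g q 0 i) (fun v => dg v 0 i)) ->
  is_diff p (fun q => dh q.1 (g q))
            (fun v => 2 * bilin C v.1 (g p) + dh p.1 (dg v)).
Proof.
move=> cg; have cx i := is_diff_base_coord i p.
apply: (is_diff_eq (is_diff_addf _ _ _ _ p (is_diff_scalef 2 _ _ p
  (is_diff_bilin C fst fst _ _ p cx cg)) (is_diff_dotp c' _ _ p cg))).
by apply/funext => v; rewrite /dh; ring.
Qed.

Lemma is_diff_dh_fibre p : is_diff p (fun q => dh q.1 q.2)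
  (fun v => 2 * bilin C v.1 p.2 + dh p.1 v.2).
Proof. by apply: is_diff_dh => i; exact: is_diff_fibre_coord. Qed.

Lemma is_diff_dh_cst u p : is_diff p (fun q => dh q.1 u)
  (fun v => 2 * bilin C v.1 u).
Proof.
apply: (is_diff_eq (is_diff_dh (fun=> u) (fun=> 0) p _)) => [i|].
  by rewrite mxE; exact: is_diff_cstf.
by apply/funext => v; rewrite dh0 addr0.
Qed.

Lemma is_diff_bilin_cst u p : is_diff p (fun q => bilin C q.2 u)
  (fun v => bilin C v.2 u).
Proof.
apply: (is_diff_eq
  (is_diff_bilin C snd snd (fun=> u) (fun=> 0) p _ _)) => [i|i|].
- exact: is_diff_fibre_coord.
- by rewrite mxE; exact: is_diff_cstf.
by apply/funext => v; rewrite bilin0r addr0.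
Qed.

Lemma is_diff_bilin_fibre p : is_diff p (fun q => bilin C q.2 q.2)
  (fun v => 2 * bilin C p.2 v.2).
Proof.
have cy i := is_diff_fibre_coord i p.
apply: (is_diff_eq (is_diff_bilin C snd snd snd snd p cy cy)).
by apply/funext => v; rewrite (bilinC _ symC v.2); ring.
Qed.

Lemma is_diff_quot (f df : TV -> R) p : h p.1 != 0 -> is_diff p f df ->
  is_diff p (fun q => f q / h q.1)
            (fun v => df v / h p.1 - f p * dh p.1 v.1 / h p.1 ^+ 2).
Proof.
move=> hp hf; apply: (is_diff_eq (is_diff_mulf _ _ _ _ p hf
  (is_diff_invf _ _ p (is_diff_hfun p) hp))).
by apply/funext => v; field.
Qed.

(** On the slit bundle the energy and its fibre derivative in the direction
    [u]; being rational functions they are easier to differentiate than the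
    square root. *)
Definition qenergy q : R :=
  2^-1 * (bilin C q.2 q.2 / h q.1) - 8^-1 * (dh q.1 q.2 / h q.1) ^+ 2.

Definition qmomentum u q : R :=
  bilin C q.2 u / h q.1 - 4^-1 * (dh q.1 q.2 / h q.1 * (dh q.1 u / h q.1)).

(** The projective factor of the candidate spray: minus half the logarithmic
    derivative of [h] along [y]. *)
Definition qfactor q : R := - 2^-1 * (dh q.1 q.2 / h q.1).

Definition qspray (i : 'I_n) q : R := qfactor q * q.2 0 i.

(** The bracket, which depends on the base component [v.1] only, is what the
    geodesic equation will compare with the derivative of the momentum. *)
Lemma is_diff_qenergy p : h p.1 != 0 -> is_diff p qenergy (fun v =>
  qmomentum v.2 p
  + ((dh p.1 p.2 ^+ 2 / h p.1 / 4 - bilin C p.2 p.2 / 2) * dh p.1 v.1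
     - dh p.1 p.2 * bilin C v.1 p.2 / 2) / h p.1 ^+ 2).
Proof.
move=> hp.
have dB := is_diff_quot _ _ p hp (is_diff_bilin_fibre p).
have dA := is_diff_quot _ _ p hp (is_diff_dh_fibre p).
apply: (is_diff_ext _ _ _ _ p (is_diff_addf _ _ _ _ p
  (is_diff_scalef 2^-1 _ _ p dB)
  (is_diff_scalef (- 8^-1) _ _ p (is_diff_mulf _ _ _ _ p dA dA)))) => [q|v].
  by rewrite /qenergy; ring.
by rewrite /qmomentum; field.
Qed.

Lemma is_diff_qmomentum u p : h p.1 != 0 -> is_diff p (qmomentum u) (fun v =>
  bilin C v.2 u / h p.1 - bilin C p.2 u * dh p.1 v.1 / h p.1 ^+ 2
  - 4^-1 * (dh p.1 p.2 / h p.1 *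
              (2 * bilin C v.1 u / h p.1 - dh p.1 u * dh p.1 v.1 / h p.1 ^+ 2)
            + dh p.1 u / h p.1 * ((2 * bilin C v.1 p.2 + dh p.1 v.2) / h p.1
                                  - dh p.1 p.2 * dh p.1 v.1 / h p.1 ^+ 2))).
Proof.
move=> hp.
have dw := is_diff_quot _ _ p hp (is_diff_bilin_cst u p).
have dA := is_diff_quot _ _ p hp (is_diff_dh_fibre p).
have du := is_diff_quot _ _ p hp (is_diff_dh_cst u p).
apply: (is_diff_ext _ _ _ _ p (is_diff_addf _ _ _ _ p dw
  (is_diff_scalef (- 4^-1) _ _ p (is_diff_mulf _ _ _ _ p dA du)))) => [q|v].
  by rewrite /qmomentum; ring.
by ring.
Qed.

Lemma is_diff_qfactor p : h p.1 != 0 -> is_diff p qfactor (fun v =>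
  - 2^-1 * ((2 * bilin C v.1 p.2 + dh p.1 v.2) / h p.1
            - dh p.1 p.2 * dh p.1 v.1 / h p.1 ^+ 2)).
Proof.
move=> hp; apply: is_diff_scalef; apply: is_diff_quot => //.
exact: is_diff_dh_fibre.
Qed.

Lemma is_diff_qspray i p : h p.1 != 0 -> is_diff p (qspray i) (fun v =>
  qfactor p * v.2 0 i + p.2 0 i *
    (- 2^-1 * ((2 * bilin C v.1 p.2 + dh p.1 v.2) / h p.1
            - dh p.1 p.2 * dh p.1 v.1 / h p.1 ^+ 2))).
Proof.
move=> hp; apply: is_diff_mulf; first exact: is_diff_qfactor.
exact: is_diff_fibre_coord.
Qed.

(** The fibre component of the spray is proportional to [y], so it acts on a
    function homogeneous in [y] as multiplication by a scalar function. *)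
Lemma qspray_direction p :
  - 2 *: (\row_i qspray i p) = (dh p.1 p.2 / h p.1) *: p.2.
Proof.
apply/rowP => i; rewrite !mxE /qspray /qfactor.
by move: (dh _ _ / _) => t; field.
Qed.

Section Metric.
Variable U : set V.
Hypotheses (oU : open U) (h0 : forall x, U x -> h x != 0).
Notation F := (quadratic_metric C c' c).
Hypothesis FF : is_finsler_metric U F.

Let oA : open (slit_bundle U) := open_slit_bundle U oU.

(** [F > 0] forces the radicand to be positive, so that squaring removes the
    root. *)
Lemma sqr_quadratic_metric p : slit_bundle U p -> F p ^+ 2 = 2 * qenergy p.
Proof.
case: p => x y [/= Ux y0]; have := finsler_gt0 FF Ux y0.
rewrite /quadratic_metric sqrtr_gt0 /= => /ltW /sqr_sqrtr ->.
by rewrite /qenergy /dh /=; field; exact: h0.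
Qed.

Lemma energyE p : slit_bundle U p -> energy F p = qenergy p.
Proof. by move=> Up; rewrite /energy sqr_quadratic_metric// mulKf. Qed.

Lemma dy_energy p j : slit_bundle U p -> dy j (energy F) p = qmomentum (e_ j) p.
Proof.
move=> Up; rewrite /dy (derive_eq_on _ oA Up energyE).
rewrite (deriveE_diff _ _ _ _ (is_diff_qenergy p (h0 _ Up.1))) /=.
by rewrite dh0 (bilin0l _ symC) !mulr0 mul0r subr0 mul0r addr0.
Qed.

Lemma dx_energy p j : slit_bundle U p -> dx j (energy F) p =
  ((dh p.1 p.2 ^+ 2 / h p.1 / 4 - bilin C p.2 p.2 / 2) * dh p.1 (e_ j)
    - dh p.1 p.2 * bilin C (e_ j) p.2 / 2) / h p.1 ^+ 2.
Proof.
move=> Up; rewrite /dx (derive_eq_on _ oA Up energyE).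
rewrite (deriveE_diff _ _ _ _ (is_diff_qenergy p (h0 _ Up.1))) /=.
by rewrite /qmomentum dh0 bilin0r !(mulr0, mul0r) subr0 add0r.
Qed.

(** With [B = C(y, y)], [w_i = C(y, e_i)] and [A = dh(y)], moving along the
    spray changes [h], [A], [w_i] and [dh(e_i)] at the rates [A],
    [2 B + A^2 / h], [A w_i / h] and [2 w_i]; inserting these in the
    momentum gives exactly the base derivative of the energy. *)
Lemma qspray_geodesic : is_geodesic_spray U F qspray.
Proof.
move=> p Up i; have hp := h0 _ Up.1.
rewrite (spray_eq_on _ qspray _ (qmomentum (e_ i)) p oA Up)//;
  last by move=> q; exact: dy_energy.
rewrite (sprayE _ _ _ _ (is_diff_qmomentum (e_ i) p hp)) qspray_direction /=.
rewrite dx_energy// (bilinC _ symC (_ *: _)) bilinZr dhZ.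
rewrite (bilinC _ symC (e_ i) p.2).
move: (bilin _ _ _) (bilin _ _ _) (dh _ _) (dh _ _) (h _) hp => b w A a H H0.
by field.
Qed.

Lemma connection_qspray p i j : slit_bundle U p -> dy j (qspray i) p =
  qfactor p * (i == j)%:R - 2^-1 * (dh p.1 (e_ j) / h p.1) * p.2 0 i.
Proof.
move=> Up; rewrite /dy.
rewrite (deriveE_diff _ _ _ _ (is_diff_qspray i p (h0 _ Up.1))) /=.
rewrite dh0 (bilin0l _ symC) mxE eqxx/= !mulr0 mul0r subr0 add0r; ring.
Qed.

(** For a spray [P y^i] with [P] of degree one in [y], the Jacobi
    endomorphism reduces to
    [- (S P + P^2) delta_ij + (2 d_{x^j} P - S P_j - P P_j) y^i] with
    [P_j = d_{y^j} P].  Here [S P = - B / h] and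
    [d_{x^j} P = S P_j = - w_j / h + A dh(e_j) / (2 h^2)], so the first
    coefficient is [F^2] and the second is minus the momentum. *)
Lemma jacobi_qspray p i j : slit_bundle U p ->
  jacobi_endomorphism qspray i j p =
  F p ^+ 2 * (i == j)%:R - qmomentum (e_ j) p * p.2 0 i.
Proof.
move=> Up; have hp := h0 _ Up.1; rewrite sqr_quadratic_metric//.
pose b k q : R := - 2^-1 * (dh q.1 (e_ k) / h q.1).
pose N q : R := qfactor q * (i == j)%:R + b j q * q.2 0 i.
have db : is_diff p (b j) (fun v => - 2^-1 *
    (2 * bilin C v.1 (e_ j) / h p.1 - dh p.1 (e_ j) * dh p.1 v.1 / h p.1 ^+ 2)).
  by apply: is_diff_scalef; apply: is_diff_quot => //; exact: is_diff_dh_cst.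
have dN := is_diff_addf _ _ _ _ p
  (is_diff_mulf _ _ _ _ p (is_diff_qfactor p hp) (is_diff_cstf (i == j)%:R p))
  (is_diff_mulf _ _ _ _ p db (is_diff_fibre_coord i p)).
have NE k l q : slit_bundle U q ->
    dy l (qspray k) q = qfactor q * (k == l)%:R + b l q * q.2 0 k.
  by move=> Uq; rewrite connection_qspray// /b; ring.
rewrite /jacobi_endomorphism /nonlinear_connection /=.
rewrite (spray_eq_on _ qspray _ N p oA Up) //; last exact: NE.
rewrite (sprayE _ _ _ _ dN) qspray_direction.
under eq_bigr do rewrite !NE//.
rewrite sum_connection_sqr.
(* Euler's identity: the factor is linear in the fibre coordinate. *)
have -> : \sum_(k < n) p.2 0 k * b k p = qfactor p.
  rewrite /qfactor (dh_sum _ p.2) mulr_suml mulr_sumr.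
  by apply: eq_bigr => k _; rewrite /b; ring.
rewrite /dx (deriveE_diff _ _ _ _ (is_diff_qspray i p hp)) /=.
rewrite mxE dh0 dhZ mxE (bilinC _ symC (e_ j) p.2) -/(dh p.1 p.2).
rewrite /qfactor /b /qenergy /qmomentum.
move: (bilin _ _ _) (bilin _ _ _) (dh _ _) (dh _ _) (h _) hp.
move: (i == j)%:R (p.2 0 i).
move=> d y B w A a H H0.
by field.
Qed.

(** Differentiating [F^2 / 2] by the chain rule turns [F F_{y^j}] into the
    momentum, which is the form it has in the Jacobi endomorphism. *)
Lemma mul_dy_metric p j : slit_bundle U p ->
  F p * dy j F p = qmomentum (e_ j) p.
Proof.
move=> Up; rewrite -dy_energy//.
have [_ /(_ j)[_ _ dF _]] := finsler_smooth FF 1%N.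
have dFp : derivable F p (ydir R j) := dF p Up.
have -> : energy F = 2^-1 *: F ^+ 2 by [].
rewrite /dy deriveZ ?deriveX//; last exact: derivableX.
by rewrite /GRing.scale/= expr1; field.
Qed.

End Metric.

End QuadraticMetric.

(** * Geodesic spray, Jacobi endomorphism and flag curvature *)

Theorem proposition3p7 (R : realType) (n : nat) (C : 'M[R]_n) (c' : 'rV[R]_n)
    (c : R) (U : set 'rV[R]_n) :
  (2 <= n)%N ->
  (forall i j : 'I_n, C i j = C j i) ->
  open U ->
  (forall x, U x -> hfun C c' c x != 0) ->
  is_finsler_metric U (quadratic_metric C c' c) ->
  [/\ forall G : 'I_n -> 'rV[R]_n * 'rV[R]_n -> R,
        is_geodesic_spray U (quadratic_metric C c' c) G <->
        (forall (x y : 'rV[R]_n) (i : 'I_n), U x -> y != 0 ->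
           G i (x, y) =
           - ((2 * bilin C x y + dotp c' y) / (2 * hfun C c' c x)) * y 0 i),
      forall G : 'I_n -> 'rV[R]_n * 'rV[R]_n -> R,
        is_geodesic_spray U (quadratic_metric C c' c) G ->
        forall (x y : 'rV[R]_n) (i j : 'I_n), U x -> y != 0 ->
          jacobi_endomorphism G i j (x, y) =
          (4 * hfun C c' c x * bilin C y y
             - (2 * bilin C x y + dotp c' y) ^+ 2)
            / (2 * hfun C c' c x) ^+ 2 * (i == j)%:R
          - (4 * hfun C c' c x * (\sum_(r < n) C r j * y 0 r)
             - (2 * bilin C x y + dotp c' y)
               * (2 * (\sum_(r < n) C r j * x 0 r) + c' 0 j))
            / (2 * hfun C c' c x) ^+ 2 * y 0 i
    & has_constant_flag_curvature U (quadratic_metric C c' c) 1].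
Proof.
move=> _ symC oU h0 FF.
have oA := open_slit_bundle _ oU.
have qG := qspray_geodesic C c' c symC U oU h0 FF.
have sprayP G : is_geodesic_spray U (quadratic_metric C c' c) G <->
    forall k q, slit_bundle U q -> G k q = qspray C c' c k q.
  split=> [GG k q Uq|GE p Up i].
    exact: geodesic_spray_unique FF GG qG Uq k.
  have GEp k := GE k p Up.
  by rewrite (spray_eq_on G _ _ _ p oA Up GEp (fun _ _ => erefl)) qG.
have qsprayE x y i : qspray C c' c i (x, y) =
    - ((2 * bilin C x y + dotp c' y) / (2 * hfun C c' c x)) * y 0 i.
  by rewrite /qspray /qfactor /dh /= invfM; ring.
split=> [G|G /sprayP GE x y i j Ux y0|].
- split=> [/sprayP GE x y i Ux y0|GE]; first by rewrite GE.
  by apply/sprayP => k [x y] [Ux y0]; rewrite GE.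
- have Up : slit_bundle U (x, y) by [].
  rewrite (jacobi_eq_on _ _ i j _ oA Up GE).
  rewrite (jacobi_qspray _ _ _ symC _ oU h0 FF)//.
  rewrite (sqr_quadratic_metric _ _ _ _ h0 FF)// /qenergy /qmomentum /dh /=.
  rewrite !bilin_delta dotp_delta; have := h0 x Ux.
  by move: (i == j)%:R => d hx; field.
- exists (qspray C c' c) => // p Up i j.
  rewrite (jacobi_qspray _ _ _ symC _ oU h0 FF)// mul1r.
  by rewrite (mul_dy_metric _ _ _ symC _ oU h0 FF).
Qed.
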